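(* Let $A\in\mathbb{Z}^{m\times n}$ with $\operatorname{rank}(A)=m<n$, $b\in\mathbb{Z}^m$, $u\in\mathbb{Z}^n$, and let $(F^B)$ be the system $Ax=b,\ 0\le x\le u,\ x\in\mathbb{Z}^n$. A strong aggregation matrix $T\in\mathbb{Q}^{1\times m}$ of size one for $(F^B)$ can be built in polynomial time; that is, there is an algorithm which, given $(A,b,u)$, outputs such a $T$ in time polynomial in the binary encoding length of $(A,b,u)$.
   Context: For $T\in\mathbb{Q}^{k\times m}$, the aggregated system $(F^B_T)$ is $TAx=Tb,\ 0\le x\le u,\ x\in\mathbb{Z}^n$, and $k$ is called the size of $T$. $T$ is a strong aggregation matrix for $(F^B)$ if $(F^B)$ and $(F^B_T)$ have the same set of solutions. *)

(* Defs.v *)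
From HB Require Import structures.
From mathcomp Require Import all_boot all_order all_algebra.

Set Implicit Arguments.
Unset Strict Implicit.
Unset Printing Implicit Defensive.

Import Order.TTheory GRing.Theory Num.Theory.

Local Open Scope ring_scope.

Section Aggregation.

Variables (m n : nat) (A : 'M[int]_(m, n)) (b : 'cV[int]_m) (u : 'cV[int]_n).

Definition in_box (x : 'cV[int]_n) : Prop :=
  forall j, 0 <= x j 0 <= u j 0.

Definition solution (x : 'cV[int]_n) : Prop :=
  A *m x = b /\ in_box x.

Definition aggregated_solution (k : nat) (T : 'M[rat]_(k, m))
    (x : 'cV[int]_n) : Prop :=
  T *m map_mx intr A *m map_mx intr x = T *m map_mx intr b /\ in_box x.

Definition strong_aggregation (k : nat) (T : 'M[rat]_(k, m)) : Prop :=
  forall x, solution x <-> aggregated_solution T x.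

End Aggregation.

Inductive symbol : Type :=
  Bit of bool | Minus | Slash | Comma | Semicolon | Hash.

Definition symbol_code (s : symbol) : bool + 'I_5 :=
  match s with
  | Bit c => inl c
  | Minus => inr (inord 0)
  | Slash => inr (inord 1)
  | Comma => inr (inord 2)
  | Semicolon => inr (inord 3)
  | Hash => inr (inord 4)
  end.

Definition symbol_decode (c : bool + 'I_5) : symbol :=
  match c with
  | inl c => Bit c
  | inr i => nth Hash [:: Minus; Slash; Comma; Semicolon] i
  end.

Lemma symbol_codeK : cancel symbol_code symbol_decode.
Proof. by case=> [c|||||] //=; rewrite inordK. Qed.

HB.instance Definition _ := Finite.copy symbol (can_type symbol_codeK).

Definition word : Type := seq symbol.

(* Most significant digit first; no leading zero, except that 0 is the
   one-digit word 0. *)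
Definition encode_nat (a : nat) : word :=
  [seq Bit (odd (a %/ 2 ^ i)) | i <- rev (iota 0 (trunc_log 2 a).+1)].

Definition encode_int (z : int) : word :=
  (if z < 0 then [:: Minus] else [::]) ++ encode_nat `|z|%N.

Definition encode_rat (q : rat) : word :=
  encode_int (numq q) ++ Slash :: encode_int (denq q).

(* Every entry is followed by Comma and every row by Semicolon, so the
   dimensions can be read off the word. *)
Definition encode_mx (S : Type) (e : S -> word) (m n : nat)
    (M : 'M[S]_(m, n)) : word :=
  flatten [seq flatten [seq rcons (e (M i j)) Comma | j <- enum 'I_n]
                 ++ [:: Semicolon] | i <- enum 'I_m].

Definition encode_system (m n : nat) (A : 'M[int]_(m, n)) (b : 'cV[int]_m)
    (u : 'cV[int]_n) : word :=
  encode_mx encode_int A ++ Hash ::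
  encode_mx encode_int b^T ++ Hash :: encode_mx encode_int u^T.

Inductive move : Type := MoveLeft | Stay | MoveRight.

(* Deterministic multi-tape Turing machines reading and writing words over
   [symbol]. A tape cell is blank ([None]), or contains an input/output symbol
   ([inl]), or a machine-specific auxiliary symbol ([inr]). All types in the
   domain of the transition function are finite, so it is a finite table. The
   machine halts when the transition function returns [None]. *)
Record turing_machine : Type := TuringMachine {
  tm_state : finType;
  tm_aux : finType;
  tm_extra_tapes : nat;
  tm_start : tm_state;
  tm_trans :
    tm_state -> {ffun 'I_tm_extra_tapes.+1 -> option (symbol + tm_aux)} ->
    option (tm_state *
      {ffun 'I_tm_extra_tapes.+1 -> option (symbol + tm_aux) * move})
}.

(* A tape that is infinite in both directions: [tape_left] lists the cells to
   the left of the head, nearest first, and [tape_right] lists the cells from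
   the scanned one rightwards; all the cells not listed are blank. *)
Record tape (cell : Type) : Type := Tape {
  tape_left : seq (option cell);
  tape_right : seq (option cell)
}.

Definition tape_read (cell : Type) (t : tape cell) : option cell :=
  head None (tape_right t).

Definition tape_update (cell : Type) (t : tape cell)
    (act : option cell * move) : tape cell :=
  let: (c, d) := act in
  let l := tape_left t in
  let r := behead (tape_right t) in
  match d with
  | MoveLeft => Tape (behead l) (head None l :: c :: r)
  | Stay => Tape l (c :: r)
  | MoveRight => Tape (c :: l) r
  end.

Section Execution.

Variable M : turing_machine.

Notation cell := (symbol + tm_aux M)%type.
Notation tape_index := 'I_(tm_extra_tapes M).+1.

Record config : Type := Config {
  cfg_state : tm_state M;
  cfg_tapes : {ffun tape_index -> tape cell}
}.

Definition tm_next (c : config) :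
    option (tm_state M * {ffun tape_index -> option cell * move}) :=
  tm_trans (cfg_state c) [ffun i => tape_read (cfg_tapes c i)].

Definition halted (c : config) : Prop := tm_next c = None.

(* A halted configuration is left unchanged. *)
Definition step (c : config) : config :=
  if tm_next c is Some (s, act)
  then Config s [ffun i => tape_update (cfg_tapes c i) (act i)]
  else c.

Definition on_tape (w : word) : seq (option cell) :=
  [seq Some (inl s) | s <- w].

(* The first tape is the input tape, the last one the output tape. *)
Definition initial (w : word) : config :=
  Config (tm_start M)
    [ffun i => Tape [::] (if i == ord0 then on_tape w else [::])].

(* The output is the word that extends from the head to the first blank. *)
Definition has_output (c : config) (v : word) : Prop :=
  exists r, tape_right (cfg_tapes c ord_max) = on_tape v ++ r
            /\ head None r = None.

Definition outputs_within (w : word) (t : nat) (v : word) : Prop :=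
  let c := iter t step (initial w) in halted c /\ has_output c v.

End Execution.

(* Main.v *)
Require Import Defs.
From HB Require Import structures.
From mathcomp Require Import all_boot all_order all_algebra.
From mathcomp Require Import zify.
Import Order.TTheory GRing.Theory Num.Theory.
Local Open Scope ring_scope.

(** Let N be the length of the word that encodes (A, b, u), and B = 2 ^ N. Every
    entry z of the input is less than 2 to the length of its own code, and these
    lengths add up to at most N; this makes B exceed every |A_i x - b_i| with x
    in the box ([residual_bound]). Hence the row with the entries
    T_i = B ^ (m - i) is a strong aggregation matrix: an expansion in base B with
    digits strictly between -B and B vanishes only when all its digits do
    ([digits_eq0], [strong_aggregation_pow2]).

    A power of 2 is written as a 1 followed by zeros, so no arithmetic is needed
    to output T: entry i only requires (m - i) N zeros. The machine [aggregator]
    holds a counter in unary notation, to which it adds N before each entry by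
    one pass over the input, and which it then copies to the output as zeros. The entries are produced from the last to the first and
    every one of them is written from right to left, so that the head of the
    output tape ends at the beginning of the output. The number of rows is the
    number of semicolons before the first hash. Each row takes O(m N) steps, and
    m <= N, hence the cubic bound [time_bound].

    Runs of the machine are described up to trailing blanks ([same_tape]), which
    the heads leave behind at the ends of the tapes. *)

(** * Computations up to trailing blanks *)

(** The two tapes carry the same infinite sequence of cells around the head;
    only the number of blanks listed at either end can differ. *)
Definition same_tape (C : Type) (t t' : tape C) : Prop :=
  nth None (tape_left t) =1 nth None (tape_left t') /\
  nth None (tape_right t) =1 nth None (tape_right t').

Lemma same_tape_refl (C : Type) (t : tape C) : same_tape C t t.
Proof. by []. Qed.

Lemma same_tape_trans (C : Type) (t1 t2 t3 : tape C) :
  same_tape C t1 t2 -> same_tape C t2 t3 -> same_tape C t1 t3.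
Proof. by case=> l12 r12 [l23 r23]; split=> i; rewrite ?l12 ?r12. Qed.

Lemma same_tape_read (C : Type) (t t' : tape C) :
  same_tape C t t' -> tape_read t = tape_read t'.
Proof. by case=> _ /(_ 0%N); rewrite !nth0. Qed.

Lemma same_tape_update (C : Type) (t t' : tape C) a :
  same_tape C t t' -> same_tape C (tape_update t a) (tape_update t' a).
Proof.
case: a => c d [eql eqr].
have eq_head : head None (tape_left t) = head None (tape_left t').
  by rewrite -!nth0.
by case: d; split=> /= -[|[|i]] //=; rewrite ?nth_behead ?eq_head ?eql ?eqr.
Qed.

Definition same_config (M : turing_machine) (c c' : config M) : Prop :=
  cfg_state c = cfg_state c' /\
  forall i, same_tape _ (cfg_tapes c i) (cfg_tapes c' i).

Lemma same_config_trans (M : turing_machine) (c1 c2 c3 : config M) :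
  same_config M c1 c2 -> same_config M c2 c3 -> same_config M c1 c3.
Proof.
case=> s12 t12 [s23 t23]; split=> [|i]; first by rewrite s12.
exact: same_tape_trans (t12 i) (t23 i).
Qed.

Lemma same_config_next (M : turing_machine) (c c' : config M) :
  same_config M c c' -> tm_next c = tm_next c'.
Proof.
case=> eqs eqt; rewrite /tm_next eqs; congr tm_trans.
by apply/ffunP=> i; rewrite !ffunE (same_tape_read _ _ _ (eqt i)).
Qed.

Lemma same_config_step (M : turing_machine) (c c' : config M) :
  same_config M c c' -> same_config M (step c) (step c').
Proof.
move=> eqc; rewrite /step (same_config_next _ _ _ eqc).
case: (tm_next c') => [[s act]|] //; split=> // i /=.
by rewrite !ffunE; apply: same_tape_update; case: eqc.
Qed.

Lemma same_config_output (M : turing_machine) (c c' : config M) v :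
  same_config M c c' -> tape_right (cfg_tapes c' ord_max) = on_tape M v ->
  has_output c v.
Proof.
case=> _ /(_ ord_max) [_ eqr] eqv; move: eqr; rewrite /has_output {}eqv.
elim: v (tape_right _) => [|s v IHv] r eqr.
  by exists r; split=> //; rewrite -nth0 eqr.
case: r eqr => [|x r] eqr; first by have := eqr 0%N.
have [r' [-> hd]] := IHv r (fun i => eqr i.+1).
by exists r'; split=> //; have /= -> := eqr 0%N.
Qed.

(** Only the final configuration is taken up to trailing blanks: the transition
    function cannot see them, so that runs still compose. *)
Definition runs (M : turing_machine) (c : config M) (k : nat) (c' : config M) :=
  same_config M (iter k (@step M) c) c'.

Lemma runs_trans (M : turing_machine) (c1 c2 c3 : config M) k l :
  runs M c1 k c2 -> runs M c2 l c3 -> runs M c1 (k + l) c3.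
Proof.
move=> run12 run23; apply: same_config_trans run23; rewrite addnC iterD.
by elim: l => //= l IHl; apply: same_config_step.
Qed.

(** A halted configuration is a fixed point of [step], so the output remains
    available at any later time. *)
Lemma runs_outputs_within (M : turing_machine) w k t c v :
  runs M (initial M w) k c -> halted c ->
  tape_right (cfg_tapes c ord_max) = on_tape M v ->
  (k <= t)%N -> outputs_within M w t v.
Proof.
move=> run halt out le_kt.
have halt_k : halted (iter k (@step M) (initial M w)).
  by rewrite /halted (same_config_next _ _ _ run).
have stay : iter t (@step M) (initial M w) = iter k (@step M) (initial M w).
  rewrite -(subnK le_kt) iterD; elim: (t - k)%N => //= d ->.
  by rewrite /step halt_k.
by rewrite /outputs_within stay; split=> //; apply: same_config_output run out.
Qed.

(** * The machine *)

Inductive phase : Type :=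
  CountRows | SkipRest | NextRow | GrowCounter | Return | EmitZeros | Done.

Definition phase_code (s : phase) : 'I_7 :=
  inord match s with
        | CountRows => 0 | SkipRest => 1 | NextRow => 2 | GrowCounter => 3
        | Return => 4 | EmitZeros => 5 | Done => 6
        end.

Definition phase_decode (i : 'I_7) : phase :=
  nth Done [:: CountRows; SkipRest; NextRow; GrowCounter; Return; EmitZeros] i.

Lemma phase_codeK : cancel phase_code phase_decode.
Proof. by case; rewrite /phase_decode /phase_code inordK. Qed.

HB.instance Definition _ := Finite.copy phase (can_type phase_codeK).

Definition cell : Type := option (symbol + void).

Definition zero : cell := Some (inl (Bit false)).

(** The machine as a function of the four scanned cells. Tape 0 is the input;
    tape 1 holds one mark for each row that remains to be output; tape 2 is the
    unary counter; tape 3 is the output. One row is one round through [NextRow],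
    [GrowCounter] (tape 0 is read backwards and each cell adds a mark to the
    counter), [Return] (tapes 0 and 2 go to their right ends; the counter is at
    least as long as the input, so tape 0 is there no later, and waits) and
    [EmitZeros] (tape 2 is read backwards and copied to the output). The
    remaining symbols of the entry are written when the phase changes. *)
Definition rule (s : phase) (c0 c1 c2 c3 : cell) :
    option (phase * ((cell * move) * (cell * move) *
                     (cell * move) * (cell * move))) :=
  let k0 := (c0, Stay) in let k1 := (c1, Stay) in
  let k2 := (c2, Stay) in let k3 := (c3, Stay) in
  let put (s : symbol) := (Some (inl s) : cell, MoveLeft) in
  match s with
  | CountRows =>
    match c0 with
    | Some (inl Semicolon) =>
      Some (CountRows, ((c0, MoveRight), (zero, MoveLeft), k2, k3))
    | Some (inl Hash) => Some (SkipRest, ((c0, MoveRight), k1, k2, k3))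
    | _ => Some (CountRows, ((c0, MoveRight), k1, k2, k3))
    end
  | SkipRest =>
    if c0 then Some (SkipRest, ((c0, MoveRight), k1, k2, k3))
    else Some (NextRow, (k0, (None, MoveRight), k2, put Semicolon))
  | NextRow =>
    (* Without rows left, the output head steps back onto the last symbol it
       wrote, which is the first one of the output. *)
    if c1 then
      Some (GrowCounter, ((None, MoveLeft), (None, MoveRight), k2, put Comma))
    else Some (Done, (k0, k1, k2, (None, MoveRight)))
  | GrowCounter =>
    if c0 then Some (GrowCounter, ((c0, MoveLeft), k1, (zero, MoveLeft), k3))
    else Some (Return, ((None, MoveRight), k1, (None, MoveRight),
                        put (Bit true)))
  | Return =>
    if c2 then
      Some (Return, ((c0, if c0 then MoveRight else Stay), k1,
                     (c2, MoveRight), k3))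
    else Some (EmitZeros, (k0, k1, (None, MoveLeft), put Slash))
  | EmitZeros =>
    if c2 then
      Some (EmitZeros, (k0, k1, (c2, MoveLeft), put (Bit false)))
    else Some (NextRow, (k0, k1, k2, put (Bit true)))
  | Done => None
  end.

Definition four (X : Type) (x0 x1 x2 x3 : X) : {ffun 'I_4 -> X} :=
  [ffun i : 'I_4 => nth x0 [:: x0; x1; x2; x3] i].

Lemma fourE (X : Type) (x0 x1 x2 x3 : X) :
  (four X x0 x1 x2 x3 (@Ordinal 4 0 isT) = x0) *
  (four X x0 x1 x2 x3 (@Ordinal 4 1 isT) = x1) *
  (four X x0 x1 x2 x3 (@Ordinal 4 2 isT) = x2) *
  (four X x0 x1 x2 x3 (@Ordinal 4 3 isT) = x3).
Proof. by rewrite !ffunE. Qed.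

Lemma four_ind (P : 'I_4 -> Prop) :
  P (@Ordinal 4 0 isT) -> P (@Ordinal 4 1 isT) ->
  P (@Ordinal 4 2 isT) -> P (@Ordinal 4 3 isT) -> forall i, P i.
Proof.
by move=> P0 P1 P2 P3 [[|[|[|[|i]]]] lti] //;
  rewrite (bool_irrelevance lti isT).
Qed.

Definition aggregator : turing_machine :=
  @TuringMachine phase void 3 CountRows
    (fun s r =>
       if rule s (r (@Ordinal 4 0 isT)) (r (@Ordinal 4 1 isT))
                 (r (@Ordinal 4 2 isT)) (r (@Ordinal 4 3 isT))
       is Some (s', (a0, a1, a2, a3)) then Some (s', four _ a0 a1 a2 a3)
       else None).

Notation mtape := (tape (symbol + void)).
Notation onto := (on_tape aggregator).

Definition conf (s : phase) (t0 t1 t2 t3 : mtape) : config aggregator :=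
  @Config aggregator s (four mtape t0 t1 t2 t3).

(** The resulting tapes may be replaced by tapes with fewer blanks listed, which
    keeps the loop invariants below free of padding. *)
Lemma conf_step s t0 t1 t2 t3 s' a0 a1 a2 a3 u0 u1 u2 u3 k c :
  rule s (tape_read t0) (tape_read t1) (tape_read t2) (tape_read t3)
    = Some (s', (a0, a1, a2, a3)) ->
  same_tape _ (tape_update t0 a0) u0 -> same_tape _ (tape_update t1 a1) u1 ->
  same_tape _ (tape_update t2 a2) u2 -> same_tape _ (tape_update t3 a3) u3 ->
  runs aggregator (conf s' u0 u1 u2 u3) k c ->
  runs aggregator (conf s t0 t1 t2 t3) k.+1 c.
Proof.
move=> eqrule eq0 eq1 eq2 eq3; rewrite -add1n; apply: runs_trans.
rewrite /runs /= /step /tm_next /= !ffunE /= eqrule.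
by split=> // i; rewrite /= ffunE; elim/four_ind: i; rewrite !fourE.
Qed.

(** The counter and the output grow to the left: the head stays on the blank
    just before them. *)
Definition counter (k : nat) : mtape := Tape [::] (None :: nseq k zero).
Definition output (v : word) : mtape := Tape [::] (None :: onto v).

Definition is_semicolon (s : symbol) : bool :=
  if s is Semicolon then true else false.
Definition is_hash (s : symbol) : bool := if s is Hash then true else false.

Lemma runs_refl (M : turing_machine) (c : config M) : runs M c 0 c.
Proof. by []. Qed.

Lemma trailing_blank (C : Type) (s : seq (option C)) :
  nth None (rcons s None) =1 nth None s.
Proof. by elim: s => [|x s IHs] [|i] //=; rewrite nth_nil. Qed.

Lemma same_tape_idle (C : Type) (t : tape C) :
  same_tape C (tape_update t (tape_read t, Stay)) t.
Proof.
by case: t => l [|c r]; split=> // i; apply: (trailing_blank _ [::]).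
Qed.

(** The given run fixes the tapes reached after one transition, so it is
    unified before the comparisons up to blanks are attempted. *)
Tactic Notation "machine_step" uconstr(rest) :=
  eapply conf_step;
    [reflexivity | | | | | eapply rest];
    try first [exact: same_tape_refl | exact: same_tape_idle].

(** * Runs of the phases *)

Lemma count_rows_run w r l a t2 t3 :
  ~~ has is_hash w ->
  runs aggregator
    (conf CountRows (Tape (onto l) (onto (w ++ Hash :: r))) (counter a)
       (counter t2) (output t3))
    (size w).+1
    (conf SkipRest (Tape (onto (Hash :: catrev w l)) (onto r))
       (counter (count is_semicolon w + a)) (counter t2) (output t3)).
Proof.
elim: w l a => [|s w IHw] l a /=; first by move=> _; machine_step runs_refl.
rewrite negb_or => /andP[not_hash no_hash].
have [semi|not_semi] := boolP (is_semicolon s).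
  case: s semi {not_hash} => // _; rewrite add1n addSnnS.
  by machine_step (IHw (Semicolon :: l) a.+1 no_hash).
by rewrite add0n; case: s not_semi not_hash => // *;
  machine_step (IHw (_ :: l) a no_hash).
Qed.

Lemma skip_rest_run w l a t2 :
  runs aggregator
    (conf SkipRest (Tape (onto l) (onto w)) (counter a) (counter t2)
       (output [::]))
    (size w).+1
    (conf NextRow (Tape (onto (catrev w l)) [::]) (Tape [::] (nseq a zero))
       (counter t2) (output [:: Semicolon])).
Proof.
elim: w l => [|s w IHw] l /=; last by machine_step (IHw (_ :: l)).
machine_step runs_refl; split=> // i; exact: (trailing_blank _ [::]).
Qed.

(** [Tape (behead s) (head None s :: r)] is what a head sees after a move to the
    left from the position between [s] and [r]; with this form the end of the
    word, where a blank is scanned, is no special case. *)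
Lemma grow_run l r t1 a v :
  runs aggregator
    (conf GrowCounter (Tape (behead (onto l)) (head None (onto l) :: onto r))
       t1 (counter a) (output v))
    (size l).+1
    (conf Return (Tape [::] (onto (catrev l r))) t1
       (Tape [::] (nseq (size l + a) zero)) (output (Bit true :: v))).
Proof.
elim: l r a => [|s l IHl] r a.
  by machine_step runs_refl; split=> // i; apply: (trailing_blank _ [::]).
have := IHl (s :: r) a.+1; rewrite addnS => run; machine_step run.
Qed.

(** The end of the counter is never met before the end of the input, so it is the
    only one that the machine has to test. *)
Lemma return_run w l a k t1 v :
  (size w <= k)%N ->
  runs aggregator
    (conf Return (Tape (onto l) (onto w)) t1
       (Tape (nseq a zero) (nseq k zero)) (output v))
    k.+1
    (conf EmitZeros (Tape (onto (catrev w l)) [::]) t1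
       (Tape (behead (nseq (k + a) zero)) [:: head None (nseq (k + a) zero)])
       (output (Slash :: v))).
Proof.
elim: k w l a => [|k IHk] w l a.
  rewrite leqn0 size_eq0 => /eqP -> /=.
  by machine_step runs_refl; split=> // i; apply: (trailing_blank _ [:: _]).
rewrite addSnnS; case: w => [|s w] /= le_wk.
  by machine_step (IHk [::] l a.+1 isT).
by machine_step (IHk w (s :: l) a.+1 le_wk).
Qed.

Lemma emit_run t0 t1 a b v :
  runs aggregator
    (conf EmitZeros t0 t1
       (Tape (behead (nseq a zero)) (head None (nseq a zero) :: nseq b zero))
       (output v))
    a.+1
    (conf NextRow t0 t1 (counter (a + b))
       (output (Bit true :: nseq a (Bit false) ++ v))).
Proof.
elim: a b v => [|a IHa] b v; first by machine_step runs_refl.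
have -> : nseq a.+1 (Bit false) ++ v = nseq a (Bit false) ++ Bit false :: v.
  by elim: a {IHa} => //= a ->.
rewrite addSnnS; machine_step (IHa b.+1 (Bit false :: v)).
Qed.

(** The code of 2 ^ e = 2 ^ e / 1, with the comma that ends a matrix entry. *)
Definition power_entry (e : nat) : word :=
  Bit true :: nseq e (Bit false) ++ [:: Slash; Bit true; Comma].

(** The counter grows from [k] to [size w + k], and this is the exponent that is
    then output. *)
Lemma row_run w j k v :
  runs aggregator
    (conf NextRow (Tape (onto (rev w)) [::]) (Tape [::] (nseq j.+1 zero))
       (counter k) (output v))
    (3 * size w + 2 * k + 4)
    (conf NextRow (Tape (onto (rev w)) [::]) (Tape [::] (nseq j zero))
       (counter (size w + k)) (output (power_entry (size w + k) ++ v))).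
Proof.
have -> : (3 * size w + 2 * k + 4 =
  (size (rev w) + 1 + ((size w + k).+1 + (size w + k).+1)).+1)%N.
  by rewrite size_rev; lia.
have trail0 : same_tape _
    (Tape (behead (onto (rev w))) [:: head None (onto (rev w)); None])
    (Tape (behead (onto (rev w))) (head None (onto (rev w)) :: onto [::])).
  by split=> // i; apply: (trailing_blank _ [:: _]).
have trail1 :
    same_tape _ (Tape [:: None] (nseq j zero)) (Tape [::] (nseq j zero)).
  by split=> // i; apply: (trailing_blank _ [::]).
eapply conf_step; [reflexivity | exact: trail0 | exact: trail1 | | | ];
  try exact: same_tape_refl.
rewrite addn1; apply: runs_trans.
  exact: (grow_run (rev w) [::] _ k (Comma :: v)).
rewrite size_rev catrevE revK cats0; apply: runs_trans.
  by apply: (return_run w [::] 0); rewrite leq_addr.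
rewrite addn0 catrevE cats0 /power_entry /= -catA.
have := emit_run (Tape (onto (rev w)) [::]) (Tape [::] (nseq j zero))
  (size w + k) 0 [:: Slash, Bit true, Comma & v].
by rewrite addn0.
Qed.

(** The exponents decrease from left to right, because the output is written
    from right to left while the counter grows. *)
Definition power_entries (w : word) (i j : nat) : word :=
  flatten [seq power_entry (e * size w) | e <- rev (iota i j)].

Lemma rows_run w j i v :
  exists2 k, (k <= j * (3 * size w + 2 * ((i + j) * size w) + 4) + 1)%N &
    exists t0 t1 t2,
    runs aggregator
      (conf NextRow (Tape (onto (rev w)) [::]) (Tape [::] (nseq j zero))
         (counter (i * size w)) (output v))
      k
      (conf Done t0 t1 t2 (Tape [::] (onto (power_entries w i.+1 j ++ v)))).
Proof.
elim: j i v => [|j IHj] i v.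
  exists 1%N => //; do 3!eexists; machine_step runs_refl; split=> // i0.
  exact: (trailing_blank _ [::]).
have [k le_k [t0 [t1 [t2 run]]]] :=
  IHj i.+1 (power_entry (i.+1 * size w) ++ v).
exists (3 * size w + 2 * (i * size w) + 4 + k)%N.
  move: le_k; set N := size w; nia.
exists t0, t1, t2; apply: runs_trans; first exact: row_run.
rewrite -mulSn; suff -> : power_entries w i.+1 j.+1 ++ v =
  power_entries w i.+2 j ++ power_entry (i.+1 * size w) ++ v by [].
by rewrite /power_entries /= rev_cons map_rcons flatten_rcons -catA.
Qed.

(** 2 (N + 2) ^ 3, a crude bound for the sum of N + 2 and the time spent in the
    rows, with at most N rows. *)
Definition time_bound : {poly nat} :=
  2%:P * (('X + 2%:P) * (('X + 2%:P) * ('X + 2%:P))).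

(** The machine reads nothing of the input but its length and the number of
    semicolons before its first hash. *)
Lemma aggregator_correct w1 r m :
  ~~ has is_hash w1 -> count is_semicolon w1 = m ->
  let w := w1 ++ Hash :: r in
  outputs_within aggregator w time_bound.[size w]
    (power_entries w 1 m ++ [:: Semicolon]).
Proof.
move=> no_hash count_m w.
have [k le_k [t0 [t1 [t2 run]]]] := rows_run w m 0 [:: Semicolon].
have start : runs aggregator (initial aggregator w) 0
    (conf CountRows (Tape (onto [::]) (onto w)) (counter 0) (counter 0)
       (output [::])).
  split=> // i; rewrite ffunE /= ffunE; elim/four_ind: i => //=;
  by split=> // i; apply/esym; apply: (trailing_blank _ [::]).
have count := count_rows_run w1 r [::] 0 0 [::] no_hash.
have skip := skip_rest_run r (Hash :: rev w1) m 0.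
have rev_w : catrev r (Hash :: rev w1) = rev w.
  by rewrite catrevE /w rev_cat rev_cons cat_rcons.
rewrite rev_w in skip; rewrite count_m addn0 catrevE cats0 in count.
have whole := runs_trans _ _ _ _ _ _ start
  (runs_trans _ _ _ _ _ _ count (runs_trans _ _ _ _ _ _ skip run)).
apply: (runs_outputs_within _ _ _ _ _ _ whole) => //; first by rewrite /= ffunE.
have le_m : (m <= size w)%N.
  by rewrite -count_m /w size_cat (leq_trans (count_size _ _)) ?leq_addr.
have -> : time_bound.[size w] =
    (2 * ((size w + 2) * ((size w + 2) * (size w + 2))))%N.
  by rewrite /time_bound !(hornerM, hornerD, hornerC, hornerX).
have size_w : size w = (size w1 + (size r).+1)%N by rewrite /w size_cat.
move: le_k le_m; rewrite !add0n; nia.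
Qed.

(** * Encodings *)

Lemma encode_int_digits z :
  all (fun s => ~~ is_semicolon s && ~~ is_hash s) (encode_int z).
Proof.
rewrite /encode_int all_cat; apply/andP; split; first by case: ifP.
by rewrite /encode_nat all_map; apply/allP.
Qed.

Lemma all_flatten (T : Type) (a : pred T) (ss : seq (seq T)) :
  all a (flatten ss) = all (all a) ss.
Proof. by elim: ss => //= s ss <-; rewrite all_cat. Qed.

Lemma encode_mx_rows (m n : nat) (A : 'M[int]_(m, n)) :
  ~~ has is_hash (encode_mx encode_int A) /\
  count is_semicolon (encode_mx encode_int A) = m.
Proof.
pose block i := flatten [seq rcons (encode_int (A i j)) Comma | j <- enum 'I_n].
have digits i : all (fun s => ~~ is_semicolon s && ~~ is_hash s) (block i).
  rewrite all_flatten all_map; apply/allP => j _ /=.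
  by rewrite all_rcons encode_int_digits.
split.
  rewrite -all_predC /encode_mx all_flatten all_map; apply/allP => i _ /=.
  rewrite all_cat /= andbT; apply: sub_all (digits i) => s.
  by case/andP.
rewrite /encode_mx count_flatten -map_comp sumnE big_map big_enum /=.
rewrite (eq_bigr (fun _ => 1%N)) ?sum1_card ?card_ord // => i _.
rewrite count_cat addn1; congr _.+1; apply/eqP.
rewrite -leqn0 leqNgt -has_count -all_predC.
by apply: sub_all (digits i) => s /andP[].
Qed.

Lemma size_encode_mx (S : Type) (e : S -> word) (m n : nat)
    (M : 'M[S]_(m, n)) :
  size (encode_mx e M) =
  (\sum_(i < m) (\sum_(j < n) (size (e (M i j))).+1).+1)%N.
Proof.
rewrite /encode_mx size_flatten sumnE /shape -map_comp big_map big_enum /=.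
apply: eq_bigr => i _; rewrite size_cat addn1; congr _.+1.
rewrite size_flatten sumnE /shape -map_comp big_map big_enum /=.
by apply: eq_bigr => j _; rewrite size_rcons.
Qed.

Lemma ltn_encode_int z : (`|z| < 2 ^ size (encode_int z))%N.
Proof.
rewrite /encode_int size_cat expnD.
have le_abs : (`|z| < 2 ^ size (encode_nat `|z|))%N.
  by rewrite /encode_nat size_map size_rev size_iota trunc_log_ltn.
by rewrite (leq_trans le_abs) // leq_pmull // expn_gt0.
Qed.

Lemma encode_nat_pow2 e :
  encode_nat (2 ^ e) = Bit true :: nseq e (Bit false).
Proof.
rewrite /encode_nat trunc_expnK // -[e.+1]addn1 iotaD rev_cat map_cat add0n /=.
rewrite divnn expn_gt0 /=; congr cons.
apply: (@eq_from_nth _ Hash); rewrite size_map size_rev size_iota ?size_nseq //.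
move=> i lt_ie; rewrite (nth_map 0%N) ?size_rev ?size_iota // nth_nseq lt_ie.
rewrite nth_rev size_iota // nth_iota; last by lia.
have -> : (2 ^ e = 2 ^ i.+1 * 2 ^ (e - i.+1))%N by rewrite -expnD subnKC.
by rewrite add0n mulnK ?expn_gt0 // oddX.
Qed.

Lemma encode_rat_pow2 e :
  rcons (encode_rat (2 ^+ e)) Comma = power_entry e.
Proof.
have -> : 2 ^+ e = (2 ^ e)%N%:Z%:Q :> rat by rewrite -[RHS]pmulrn natrX.
rewrite /encode_rat numq_int denq_int /encode_int /= encode_nat_pow2.
by rewrite (encode_nat_pow2 0) /= rcons_cat.
Qed.

(** * The aggregation matrix *)

(** Modulo B the sum is its lowest digit, which is therefore 0; then the sum can
    be divided by B. *)
Lemma digits_eq0 (B : int) (m : nat) (r : 'I_m -> int) :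
  (forall i, `|r i| < B) -> \sum_(i < m) r i * B ^+ i = 0 ->
  forall i, r i = 0.
Proof.
elim: m r => [|m IHm] r lt_rB; first by move=> _ [].
have B_gt0 : 0 < B := le_lt_trans (normr_ge0 _) (lt_rB ord0).
rewrite big_ord_recl expr0 mulr1 => sum0.
pose q := \sum_(i < m) r (lift ord0 i) * B ^+ i.
have {}sum0 : r ord0 + B * q = 0.
  rewrite -[RHS]sum0; congr (_ + _); rewrite mulr_sumr.
  by apply: eq_bigr => i _; rewrite /= /bump add1n exprS mulrCA.
have q0 : q = 0 by have := lt_rB ord0; nia.
have r0 : r ord0 = 0 by move: sum0; rewrite q0 mulr0 addr0.
move=> i; case: (unliftP ord0 i) => [j ->|-> //].
by apply: (IHm (fun j => r (lift ord0 j))) => // k.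
Qed.

Lemma ltn_sum_prod (I : finType) (f : I -> nat) :
  (\sum_i f i < \prod_i (f i).+1)%N.
Proof.
by elim/big_rec2: _ => // i p s _ lt_sp; nia.
Qed.

Lemma size_encode_system (m n : nat) (A : 'M[int]_(m, n)) (b : 'cV[int]_m)
    (u : 'cV[int]_n) i :
  (\sum_j (size (encode_int (A i j)) + size (encode_int (u j ord0))) +
     size (encode_int (b i ord0)) <= size (encode_system A b u))%N.
Proof.
rewrite /encode_system [leqRHS]size_cat /= [X in (_ + X.+1)%N]size_cat /=.
rewrite !size_encode_mx !big_ord1 (bigD1 i) //= big_split /=.
have le_b : (size (encode_int (b i ord0)) <=
    \sum_j (size (encode_int (b^T ord0 j))).+1)%N.
  by rewrite (bigD1 i) //= mxE; lia.
have le_u : (\sum_j size (encode_int (u j ord0)) <=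
    \sum_j (size (encode_int (u^T ord0 j))).+1)%N.
  by apply: leq_sum => j _; rewrite mxE.
have le_A : (\sum_j size (encode_int (A i j)) <=
    \sum_j (size (encode_int (A i j))).+1)%N by apply: leq_sum.
have arith a c d a' c' d' e : (d <= d' -> c <= c' -> a <= a' ->
  a + c + d <= a'.+1 + e + (d'.+1 + c'.+2).+1)%N by lia.
exact: arith.
Qed.

(** With la and lu the lengths of the codes of A_ij and u_j, the product
    |A_ij| |u_j| is less than 2 ^ (la + lu); [ltn_sum_prod] turns the sum of
    these products into one power of 2, and |b_i| contributes one more factor. *)
Lemma residual_bound (m n : nat) (A : 'M[int]_(m, n)) (b : 'cV[int]_m)
    (u : 'cV[int]_n) (x : 'cV[int]_n) i :
  in_box u x ->
  `|(A *m x - b) i ord0| < (2 ^ size (encode_system A b u))%N%:Z.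
Proof.
move=> box; rewrite !mxE.
have le_abs : `|\sum_j A i j * x j ord0 - b i ord0| <=
    (\sum_j `|A i j| * `|u j ord0| + `|b i ord0|)%N%:Z.
  rewrite PoszD abszE (le_trans (ler_normB _ _)) // lerD2r.
  rewrite (le_trans (ler_norm_sum _ _ _)) // -natz natr_sum ler_sum // => j _.
  rewrite natz PoszM !abszE normrM ler_wpM2l //.
  have /andP[x_ge0 le_xu] := box j.
  by rewrite (ger0_norm x_ge0) (le_trans le_xu) // ler_norm.
apply: le_lt_trans le_abs _; rewrite ltz_nat.
pose la j := size (encode_int (A i j)).
pose lu j := size (encode_int (u j ord0)).
have lt_sum : (\sum_j `|A i j| * `|u j ord0| < 2 ^ \sum_j (la j + lu j))%N.
  apply: leq_trans (ltn_sum_prod _ _) _; rewrite expn_sum.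
  apply: leq_prod => j _; rewrite expnD.
  by apply: ltn_mul; apply: ltn_encode_int.
have lt_b := ltn_encode_int (b i ord0).
apply: (@leq_trans (2 ^ (\sum_j (la j + lu j) + size (encode_int (b i ord0))))).
  by rewrite expnD; nia.
by rewrite leq_exp2l // size_encode_system.
Qed.

(** The exponents are positive multiples of N, so the lowest digit of the
    expansion has weight 2 ^ N, not 1; this common factor is cancelled first. *)
Lemma strong_aggregation_pow2 (m n : nat) (A : 'M[int]_(m, n))
    (b : 'cV[int]_m) (u : 'cV[int]_n) N :
  (size (encode_system A b u) <= N)%N ->
  strong_aggregation A b u (\row_i 2 ^+ ((m - i) * N)).
Proof.
move=> le_N x; split=> [] [eqAb box]; split=> //.
  by rewrite -mulmxA -map_mxM eqAb.
apply/eqP; rewrite -subr_eq0; apply/eqP/colP => i; rewrite [RHS]mxE.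
pose B : int := (2 ^ N)%N%:Z.
have lt_rB j : `|(A *m x - b) j ord0| < B.
  apply: lt_le_trans (residual_bound _ _ A b u x j box) _.
  by rewrite lez_nat leq_exp2l.
pose r (j : 'I_m) := (A *m x - b) (rev_ord j) ord0.
rewrite -[i]rev_ordK -/(r _); apply: (digits_eq0 B) => [j|]; first exact: lt_rB.
move/eqP: eqAb; rewrite -mulmxA -subr_eq0 -mulmxBr -map_mxM -map_mxB.
move=> /eqP/matrixP/(_ ord0 ord0); rewrite mxE [RHS]mxE => sum0.
have B_neq0 : B != 0 by rewrite /B; lia.
suff /eqP : B * \sum_(j < m) r j * B ^+ j = 0.
  by rewrite mulf_eq0 (negPf B_neq0) => /eqP.
apply/eqP; rewrite -(intr_eq0 rat) -[X in _ == X]sum0.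
rewrite (reindex_inj rev_ord_inj) /= mulr_sumr rmorph_sum /=.
apply/eqP/eq_bigr => j _; rewrite /r rev_ordK [RHS]mulrC 2![in RHS]mxE.
rewrite mulrCA -exprS rmorphM rmorphXn /=; congr (_ * _).
by rewrite -subSn // subSS mulnC exprM /B -pmulrn natrX.
Qed.

Lemma encode_row (m : nat) (w : word) :
  encode_mx encode_rat (\row_(i < m) 2 ^+ ((m - i) * size w)) =
  power_entries w 1 m ++ [:: Semicolon].
Proof.
rewrite /encode_mx enum_ordSl enum_ord0 /= cats0; congr (flatten _ ++ _).
under eq_map => i do rewrite mxE encode_rat_pow2.
rewrite (map_comp (fun e => power_entry (e * size w))
  (fun i : 'I_m => m - i)%N).
congr map; rewrite (map_comp (subn m) val) val_enum_ord.
apply: (@eq_from_nth _ 0%N); rewrite size_map ?size_rev !size_iota //.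
move=> i lt_im.
rewrite (nth_map 0%N) ?size_iota // nth_rev size_iota //.
by rewrite !nth_iota //; lia.
Qed.

Theorem proposition3 :
  exists (M : turing_machine) (p : {poly nat}),
    forall (m n : nat) (A : 'M[int]_(m, n)) (b : 'cV[int]_m) (u : 'cV[int]_n),
      \rank (map_mx (intr : int -> rat) A) = m -> (m < n)%N ->
      let w := encode_system A b u in
      exists T : 'M[rat]_(1, m),
        outputs_within M w p.[size w] (encode_mx encode_rat T) /\
        strong_aggregation A b u T.
Proof.
exists aggregator, time_bound => m n A b u _ _ w.
exists (\row_i 2 ^+ ((m - i) * size w)); split.
  have [no_hash count_m] := encode_mx_rows m n A.
  by rewrite encode_row; apply: aggregator_correct.
exact: strong_aggregation_pow2.
Qed.
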